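(* Let $n,m$ be positive integers with $n\geq 2$, and let $q=2^m$. Let $G_1=PSp(2n,q)\rtimes \operatorname{Aut}(\mathbb F_q)$ and $G_2=Sp(2n,q)\rtimes \operatorname{Aut}(\mathbb F_q)$ be regarded as permutation groups in their natural permutation actions on $\Omega_1=PG(2n-1,q)$ (the set of points of the projective space) and on $\Omega_2=\mathbb F_q^{2n}\setminus\{0\}$, respectively. Then $G_1$ does not contain a sharply transitive set of permutations of $\Omega_1$, and $G_2$ does not contain a sharply transitive set of permutations of $\Omega_2$.
   Context: A set $S$ of permutations of a finite set $\Omega$ is called sharply transitive on $\Omega$ if for all $x,y\in\Omega$ there is a unique $s\in S$ with $x^s=y$ (where $x^s$ is the image of $x$ under $s$); $S$ need not be a subgroup. $\mathbb F_q$ is the field with $q$ elements and $PG(2n-1,q)$ is the set of $1$-dimensional subspaces of $\mathbb F_q^{2n}$. $Sp(2n,q)$ is the group of linear automorphisms of $\mathbb F_q^{2n}$ preserving the standard nondegenerate alternating bilinear form, and $PSp(2n,q)$ is the group it induces on $PG(2n-1,q)$. The group $\operatorname{Aut}(\mathbb F_q)$ of field automorphisms acts coordinatewise on $\mathbb F_q^{2n}$ (with respect to a basis in which the form has the standard Gram matrix with entries in the prime field), normalizes $Sp(2n,q)$, and induces an action on $PG(2n-1,q)$; the semidirect products act accordingly by semilinear maps. *)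

(* Defs.v *)
From HB Require Import structures.
From mathcomp Require Import all_boot all_order all_algebra all_fingroup.

Set Implicit Arguments.
Unset Strict Implicit.
Unset Printing Implicit Defensive.

Import GRing.Theory.
Local Open Scope ring_scope.

(* S is an arbitrary set of permutations, not necessarily a subgroup. *)
Definition sharply_transitive (T : finType) (S : {set {perm T}}) : Prop :=
  forall x y : T, exists! s : {perm T}, s \in S /\ s x = y.

HB.instance Definition _ (F : finFieldType) (vT : vectType F) :=
  CanIsCountable (@VectorInternalTheory.vs2mxK F vT).
HB.instance Definition _ (F : finFieldType) (vT : vectType F) :=
  isFinite.Build {vspace vT}
    (pcan_enumP (can_pcan (@VectorInternalTheory.vs2mxK F vT))).

Section Symplectic.

Variables (F : finFieldType) (n : nat).

Local Notation V := 'rV[F]_(n + n).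

Definition sympl_mx : 'M[F]_(n + n) := block_mx 0 1%:M (- 1%:M) 0.

Definition sympl_form (u v : V) : F := (u *m sympl_mx *m v^T) 0 0.

(* A matrix A is identified with the automorphism v |-> v *m A. *)
Definition Sp : {set 'M[F]_(n + n)} :=
  [set A | (A \in unitmx) &&
    [forall u, forall v, sympl_form (u *m A) (v *m A) == sympl_form u v]].

Definition field_Aut : {set {perm F}} :=
  [set s : {perm F} | [&& s 1 == 1,
     [forall x, forall y, s (x + y) == s x + s y] &
     [forall x, forall y, s (x * y) == s x * s y]]].

Lemma field_AutP (s : {perm F}) :
  reflect (zmod_morphism s /\ monoid_morphism s) (s \in field_Aut).
Proof.
rewrite inE; apply: (iffP and3P) => [[/eqP s1 sD sM]|[sB [s1 sM]]].
  have sDE x y : s (x + y) = s x + s y.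
    by move/forallP/(_ x)/forallP/(_ y)/eqP: sD.
  split; last first.
    by split=> // x y; move/forallP/(_ x)/forallP/(_ y)/eqP: sM.
  by move=> x y; apply/esym/eqP; rewrite subr_eq -sDE subrK.
split; first exact/eqP.
  have s0 : s 0 = 0 by rewrite -{1}(subrr 0) sB subrr.
  have sN y : s (- y) = - s y by rewrite -(sub0r y) sB s0 sub0r.
  by apply/'forall_'forall_eqP => x y; rewrite -{1}(opprK y) sB sN opprK.
by apply/'forall_'forall_eqP.
Qed.

Definition linear_act (A : 'M[F]_(n + n)) (v : V) : V := v *m A.

Definition field_act (s : {perm F}) (v : V) : V := map_mx s v.

Definition nzvec : finType := {v : V | v != 0}.

Definition point : finType := {U : {vspace V} | \dim U == 1%N}.

(* The permutations of the nonzero vectors (resp. of the points) induced by the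
   maps f t of V, for t in D; a point U goes to its image under f t. *)
Definition vec_perms (T : finType) (f : T -> V -> V) (D : {set T}) :
    {set {perm nzvec}} :=
  [set s : {perm nzvec} |
    [exists t in D, forall x, val (s x) == f t (val x)]].

Definition point_perms (T : finType) (f : T -> V -> V) (D : {set T}) :
    {set {perm point}} :=
  [set s : {perm point} |
    [exists t in D, forall U,
       [set w in val (s U)] == f t @: [set v in val U]]].

Definition PSp : {set {perm point}} := point_perms linear_act Sp.

Definition Aut_point : {set {perm point}} := point_perms field_act field_Aut.

Definition Sp_vec : {set {perm nzvec}} := vec_perms linear_act Sp.

Definition Aut_vec : {set {perm nzvec}} := vec_perms field_act field_Aut.

(* These products of sets are inner semidirect products: see G1_sdprod and
   G2_sdprod. *)
Definition G1 : {set {perm point}} := (PSp * Aut_point)%g.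

Definition G2 : {set {perm nzvec}} := (Sp_vec * Aut_vec)%g.

Section Closure.
Variables (T : finType) (f : T -> V -> V) (D : {set T}).
Hypothesis D1 : exists2 t, t \in D & f t =1 id.
Hypothesis DM : forall t u, t \in D -> u \in D ->
  exists2 r, r \in D & f r =1 f u \o f t.

Lemma vec_perms_group_set : group_set (vec_perms f D).
Proof.
apply/group_setP; split.
  have [t Dt ft] := D1; rewrite inE; apply/exists_inP; exists t => //.
  by apply/forallP => x; rewrite perm1 ft.
move=> s1 s2; rewrite !inE => /exists_inP[t Dt /forallP ht].
move=> /exists_inP[u Du /forallP hu]; have [r Dr fr] := DM Dt Du.
apply/exists_inP; exists r => //; apply/forallP => x.
by rewrite permM (eqP (hu _)) (eqP (ht _)) fr.
Qed.

Lemma point_perms_group_set : group_set (point_perms f D).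
Proof.
apply/group_setP; split.
  have [t Dt ft] := D1; rewrite inE; apply/exists_inP; exists t => //.
  by apply/forallP => x; rewrite perm1 (eq_imset _ ft) imset_id.
move=> s1 s2; rewrite !inE => /exists_inP[t Dt /forallP ht].
move=> /exists_inP[u Du /forallP hu]; have [r Dr fr] := DM Dt Du.
apply/exists_inP; exists r => //; apply/forallP => x.
by rewrite permM (eqP (hu _)) (eqP (ht _)) (eq_imset _ fr) -imset_comp.
Qed.

End Closure.

Lemma Sp_form A u v :
  A \in Sp -> sympl_form (u *m A) (v *m A) = sympl_form u v.
Proof. by rewrite inE => /andP[_ /forallP/(_ u)/forallP/(_ v)/eqP]. Qed.

Lemma Sp_id : exists2 A, A \in Sp & linear_act A =1 id.
Proof.
exists 1%:M; last by move=> v; rewrite /linear_act mulmx1.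
by rewrite inE unitmx1; apply/'forall_'forall_eqP => u v; rewrite !mulmx1.
Qed.

Lemma Sp_mul A B : A \in Sp -> B \in Sp ->
  exists2 C, C \in Sp & linear_act C =1 linear_act B \o linear_act A.
Proof.
move=> SA SB; exists (A *m B); last by move=> v; rewrite /linear_act /= mulmxA.
rewrite inE unitmx_mul; move: (SA) (SB); rewrite !inE => /andP[-> _] /andP[-> _].
by apply/'forall_'forall_eqP => u v; rewrite !mulmxA !Sp_form.
Qed.

Lemma field_Aut_id : exists2 s, s \in field_Aut & field_act s =1 id.
Proof.
exists 1%g; last by move=> v; apply/rowP => i; rewrite mxE perm1.
apply/field_AutP; split; first by move=> x y; rewrite !perm1.
by split=> [|x y]; rewrite !perm1.
Qed.

Lemma field_Aut_mul s t : s \in field_Aut -> t \in field_Aut ->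
  exists2 r, r \in field_Aut & field_act r =1 field_act t \o field_act s.
Proof.
move=> /field_AutP[sB [s1 sM]] /field_AutP[tB [t1 tM]].
exists (s * t)%g; last by move=> v; apply/rowP => i; rewrite !mxE permM.
apply/field_AutP; split; first by move=> x y; rewrite !permM sB tB.
by split=> [|x y]; rewrite !permM ?s1 ?t1 // sM tM.
Qed.

Canonical Sp_vec_group : {group {perm nzvec}} :=
  @Group _ Sp_vec (vec_perms_group_set Sp_id Sp_mul).
Canonical Aut_vec_group : {group {perm nzvec}} :=
  @Group _ Aut_vec (vec_perms_group_set field_Aut_id field_Aut_mul).
Canonical PSp_group : {group {perm point}} :=
  @Group _ PSp (point_perms_group_set Sp_id Sp_mul).
Canonical Aut_point_group : {group {perm point}} :=
  @Group _ Aut_point (point_perms_group_set field_Aut_id field_Aut_mul).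

Lemma field_Aut_norm s A : s \in field_Aut -> A \in Sp ->
  exists2 B, B \in Sp &
    forall v, field_act s (linear_act A v) = linear_act B (field_act s v).
Proof.
move=> /field_AutP[sB sM] SA.
have [f fE] : exists f : {rmorphism F -> F}, (s : F -> F) = f.
  pose zm := GRing.isZmodMorphism.Build F F s sB.
  pose mm := GRing.isMonoidMorphism.Build F F s sM.
  by pose f : {rmorphism F -> F} := HB.pack (s : F -> F) zm mm; exists f.
exists (map_mx f A) => [|v]; last by rewrite /linear_act /field_act fE map_mxM.
have uA : A \in unitmx by move: SA; rewrite inE => /andP[].
rewrite inE map_unitmx uA /=; apply/'forall_'forall_eqP => u v.
have sK (w : V) : w = map_mx f (map_mx (s^-1)%g w).
  by apply/matrixP => i j; rewrite !mxE -fE permKV.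
have sJ : sympl_mx = map_mx f sympl_mx.
  by rewrite /sympl_mx map_block_mx !map_mx0 map_mxN map_mx1.
have key (w x : V) :
    sympl_form (map_mx f w) (map_mx f x) = f (sympl_form w x).
  by rewrite /sympl_form {1}sJ map_trmx -!map_mxM mxE.
by rewrite (sK u) (sK v) -!map_mxM !key Sp_form.
Qed.

Lemma G2_sdprod :
  (Sp_vec ><| Aut_vec = G2)%g.
Proof.
apply: sdprodE => /=.
  apply/subsetP => s; rewrite inE => /exists_inP[r Dr /forallP hr].
  rewrite inE; apply/subsetP => _ /imsetP[a + ->].
  rewrite !inE => /exists_inP[A SA /forallP hA].
  have [B SB hB] := field_Aut_norm Dr SA.
  apply/exists_inP; exists B => //; apply/forallP => x.
  rewrite -[x](permKV s) permJ (eqP (hr _)) (eqP (hA _)) hB.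
  by rewrite (eqP (hr _)).
apply/trivgP/subsetP => s; rewrite !inE => /andP[].
move=> /exists_inP[A SA /forallP hA] /exists_inP[r /field_AutP[rB [r1 rM]] /forallP hr].
have r0 : r 0 = 0 by rewrite -{1}(subrr 0) rB subrr.
suff A1 : A = 1%:M.
  apply/eqP/permP => x; apply/val_inj.
  by rewrite (eqP (hA _)) A1 /linear_act mulmx1 perm1.
apply/row_matrixP => i; rewrite rowE row1.
have ei : (delta_mx 0 i : V) != 0.
  by apply/eqP => /rowP/(_ i)/eqP; rewrite !mxE !eqxx oner_eq0.
have := hA (exist (fun v : V => v != 0) _ ei); rewrite (eqP (hr _)) /= /linear_act => /eqP <-.
by apply/rowP => j; rewrite !mxE; case: (_ && _).
Qed.

Lemma G1_sdprod :
  (PSp ><| Aut_point = G1)%g.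
Proof.
apply: sdprodE => /=.
  apply/subsetP => s; rewrite inE => /exists_inP[r Dr /forallP hr].
  rewrite inE; apply/subsetP => _ /imsetP[a + ->].
  rewrite !inE => /exists_inP[A SA /forallP hA].
  have [B SB hB] := field_Aut_norm Dr SA.
  apply/exists_inP; exists B => //; apply/forallP => x.
  rewrite -[x](permKV s) permJ (eqP (hr _)) (eqP (hA _)) (eqP (hr _)).
  by rewrite -(imset_comp (field_act r)) -(imset_comp (linear_act B));
    apply/eqP/eq_imset => v /=; rewrite hB.
apply/trivgP/subsetP => s; rewrite !inE => /andP[].
move=> /exists_inP[A SA /forallP hA] /exists_inP[r /field_AutP[rB [r1 rM]] /forallP hr].
have r0 : r 0 = 0 by rewrite -{1}(subrr 0) rB subrr.
have fixA (v : V) : v != 0 -> map_mx r v = v -> exists c, v *m A = c *: v.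
  move=> nzv rv; have dv : \dim <[v]> == 1%N by rewrite dim_vline nzv.
  pose P : point := exist (fun U : {vspace V} => \dim U == 1%N) <[v]>%VS dv.
  have : v *m A \in [set w in val (s P)].
    by rewrite (eqP (hA P)); apply/imsetP; exists v; rewrite // inE memv_line.
  rewrite (eqP (hr P)) => /imsetP[w]; rewrite inE => /vlineP[c ->] ->.
  exists (r c); rewrite -{2}rv; apply/rowP => j; by rewrite !mxE rM.
suff [c Ac] : exists c, A = c%:M.
  have c0 (i : 'I_(n + n)) : c != 0.
    apply/eqP => c0; move: SA; rewrite inE Ac c0 => /andP[].
    rewrite unitmxE det_scalar expr0n unitfE.
    by rewrite (gtn_eqF (leq_ltn_trans (leq0n i) (ltn_ord i))) eqxx.
  apply/eqP/permP => U; apply/val_inj/vspaceP => v; rewrite perm1.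
  have [->|nzv] := eqVneq v 0; first by rewrite !mem0v.
  have [i _] : exists i, v 0 i != 0 by apply/rV0Pn.
  have <- : (v \in [set w in val (s U)]) = (v \in val (s U)) by rewrite inE.
  rewrite (eqP (hA U)); apply/imsetP/idP => [[w]|Uv].
    by rewrite inE /linear_act Ac mul_mx_scalar => Uw ->; rewrite memvZ.
  exists (c^-1 *: v); first by rewrite inE memvZ.
  by rewrite /linear_act Ac mul_mx_scalar scalerA divff ?scale1r // (c0 i).
case: (pickP (@predT 'I_(n + n))) => [i0 _|no]; last first.
  by exists 0; apply/matrixP => i; have := no i.
have [||c hc] := fixA (const_mx 1).
- by apply/eqP => /rowP/(_ i0)/eqP; rewrite !mxE oner_eq0.
- by apply/rowP => j; rewrite !mxE.
exists c; apply/row_matrixP => i; rewrite -scalemx1 linearZ /= row1.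
have diagA k : exists d, row k A = d *: delta_mx 0 k.
  rewrite rowE; apply: fixA.
    by apply/eqP => /rowP/(_ k)/eqP; rewrite !mxE !eqxx oner_eq0.
  by apply/rowP => j; rewrite !mxE; case: (_ && _).
have off k j : k != j -> A k j = 0.
  move=> nkj; have [d /rowP/(_ j)] := diagA k; rewrite !mxE eqxx eq_sym.
  by rewrite (negPf nkj) mulr0.
have Aii : A i i = c.
  have /rowP/(_ i) := hc; rewrite !mxE mulr1 => <-.
  rewrite (bigD1 i) //= big1 ?addr0 => [|k nki]; first by rewrite mxE mul1r.
  by rewrite off // mulr0.
have [d dE] := diagA i; rewrite dE; congr (_ *: _).
by move/rowP/(_ i): dE; rewrite !mxE !eqxx mulr1 Aii.
Qed.

End Symplectic.

(* Main.v *)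
Require Import Defs.
From mathcomp Require Import all_boot all_order all_algebra all_fingroup.
From mathcomp Require Import all_field ring.

(** The obstruction is a parity count.  If S is sharply transitive on Omega and
    B, C are subsets of Omega, then the pairs (x, y) in C x B are partitioned by
    the unique s in S with x^s = y, so that
      sum_(s in S) |C^s :&: B| = |C| |B|
    ([sharply_transitive_incidence]).  Hence if |B| and |C| are odd, some
    |C^s :&: B| must be odd.

    In even characteristic the alternating form is the polarization of the
    hyperbolic quadratic form Q(x, y) = sum_i x_i y_i.  Take for B the nonzero
    singular vectors of Q and for C the nonzero vectors of a plane <u, v> on
    which the alternating form is nondegenerate.
    - |C| = q^2 - 1 is odd.
    - |B| is odd as soon as n >= 2: pairs (x, y) with Q(x, y) = 0, zero
      included, are matched by translating y by a nonzero vector orthogonal to x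
      that depends on x only ([even_card_quad_zeros]).
    - A semilinear map preserving the alternating form up to scalars and field
      automorphisms sends <u, v> to another nondegenerate plane, and such a
      plane contains an even number of nonzero singular vectors, which are
      matched by the reflection in any nonsingular vector of the plane
      ([even_card_binary_zeros]).
    So no family of such maps is sharply transitive on the nonzero vectors
    ([no_sharply_transitive_semisymplectic_family]).

    For G2 a sharply transitive set is such a family.  For G1, let each
    permutation s of the points be induced by the semilinear map h_s; then s
    maps <x> to <y> if and only if c h_s(x) = y for some nonzero scalar c, which
    is then unique.  The maps c h_s therefore form a family that is sharply
    transitive on nonzero vectors, and the same argument applies. *)

Set Implicit Arguments.
Unset Strict Implicit.
Unset Printing Implicit Defensive.

Import GRing.Theory.

(** * Counting *)

Lemma even_card_involution (T : finType) (f : T -> T) (A : {set T}) :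
    {in A, forall x, f x \in A} -> {in A, forall x, f (f x) = x} ->
    {in A, forall x, f x != x} ->
  ~~ odd #|A|.
Proof.
have [k leAk] := ubnP #|A|; elim: k A leAk => // k IHk A leAk fA fK f_neq.
have [->|[x Ax]] := set_0Vmem A; first by rewrite cards0.
have Afx := fA x Ax; have fxx := f_neq x Ax.
have cardA : #|A| = #|A :\ x :\ f x|.+2.
  by rewrite (cardsD1 x A) (cardsD1 (f x) (A :\ x)) !inE fxx Ax Afx.
rewrite cardA /= negbK; apply: IHk.
- by move: leAk; rewrite cardA => /ltnW.
- move=> y; rewrite !inE => /and3P[yfx yx Ay]; rewrite fA // andbT.
  apply/andP; split.
    by apply: contra_neq yx => /(congr1 f); rewrite !fK.
  by apply: contra_neq yfx => <-; rewrite fK.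
- by move=> y; rewrite !inE => /and3P[_ _ /fK].
- by move=> y; rewrite !inE => /and3P[_ _ /f_neq].
Qed.

(** Both sides count the triples (x, y, i) with f i x = y.  The source X is kept
    apart from the target Y so that the set C can be parametrized. *)
Lemma sharply_transitive_incidence (I X Y : finType) (D : {set I})
    (f : I -> X -> Y) (C : {set X}) (B : {set Y}) :
    (forall x y, x \in C -> y \in B -> exists! i, i \in D /\ f i x = y) ->
  \sum_(i in D) #|[set x in C | f i x \in B]| = #|C| * #|B|.
Proof.
move=> ftr.
have cardE i : #|[set x in C | f i x \in B]| =
    \sum_(x in C) \sum_(y in B) (f i x == y).
  rewrite -sum1dep_card big_mkcondr; apply: eq_bigr => x _.
  have [fxB|fxB] := boolP (f i x \in B).
    rewrite (bigD1 (f i x)) //= eqxx big1 // => y /andP[_].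
    by rewrite eq_sym => /negPf ->.
  rewrite big1 // => y By; case: eqP => // fxy.
  by rewrite fxy By in fxB.
rewrite (eq_bigr _ (fun i _ => cardE i)) exchange_big /= -sum_nat_const.
apply: eq_bigr => x Cx; rewrite exchange_big /= -sum1_card.
apply: eq_bigr => y By; have [i0 [[Di0 fi0] i0U]] := ftr x y Cx By.
rewrite (bigD1 i0) //= fi0 eqxx big1 // => i /andP[Di ii0].
by case: eqP => // fi; rewrite (i0U i) ?eqxx in ii0.
Qed.

(** * Binary quadratic forms in characteristic 2 *)

Section BinaryForm.

Local Open Scope ring_scope.

Variable F : finFieldType.
Hypothesis F2 : 2%N \in [pchar F].

(** Since b != 0 the form does not vanish identically, and the reflection in a
    vector w with q w != 0 preserves q and is an involution.  It fixes only the
    multiples of w, none of which is a nonzero zero of q. *)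
Lemma even_card_binary_zeros (a b c : F) : b != 0 ->
  ~~ odd #|[set p : F * F | (p != (0, 0)) &&
             (a * p.1 ^+ 2 + b * (p.1 * p.2) + c * p.2 ^+ 2 == 0)]|.
Proof.
move=> b0; have two0 : 2 = 0 :> F by apply: (pcharf0 F2).
pose q (p : F * F) := a * p.1 ^+ 2 + b * (p.1 * p.2) + c * p.2 ^+ 2.
have [w qw] : exists w, q w != 0.
  have [a0|a0] := eqVneq a 0; last first.
    by exists (1, 0); rewrite /q /= !(expr0n, mulr0, mul0r, addr0) expr1n mulr1.
  have [c0|c0] := eqVneq c 0; last first.
    by exists (0, 1); rewrite /q /= !(expr0n, mulr0, mul0r, add0r) expr1n mulr1.
  by exists (1, 1); rewrite /q /= a0 c0 !(mul0r, mul1r, mulr1, addr0, add0r).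
(* The reflection in w for the polar form b * (p1 * w2 + p2 * w1) of q. *)
pose t (p : F * F) := b * (p.1 * w.2 + p.2 * w.1) / q w.
pose r (p : F * F) : F * F := (p.1 + t p * w.1, p.2 + t p * w.2).
have rK p : r (r p) = p.
  have tr : t (r p) = t p.
    (* w is orthogonal to itself, as the polar form is alternating *)
    have -> : t (r p) = t p + 2 * (b * t p * w.1 * w.2 / q w).
      by rewrite /r /t /=; move: (q w)^-1 => qw'; ring.
    by rewrite two0 mul0r addr0.
  rewrite /r tr; case: p {tr} => x y /=; set s := t _.
  by congr pair; rewrite -addrA -mulr2n -mulr_natl two0 mul0r addr0.
have qr p : q (r p) = q p.
  have -> : q (r p) = q p + t p * (b * (p.1 * w.2 + p.2 * w.1)) + t p * (t p * q w)
      + 2 * (t p * (a * p.1 * w.1 + c * p.2 * w.2)).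
    by rewrite /q /r /=; ring.
  rewrite /t mulfVK // two0 mul0r addr0 -addrA -mulr2n -mulr_natl two0.
  by rewrite mul0r addr0.
have r0 p : q p = 0 -> r p = p -> p = (0, 0).
  move=> qp rp; have [rp1 rp2] : t p * w.1 = 0 /\ t p * w.2 = 0.
    move: rp; rewrite /r [in RHS](surjective_pairing p) => -[rp1 rp2].
    split; first by apply: (addrI p.1); rewrite addr0.
    by apply: (addrI p.2); rewrite addr0.
  have tp : t p = 0.
    apply: contraNeq qw => tp; move: rp1 rp2 => /eqP + /eqP.
    rewrite (mulf_eq0 (t p)) (mulf_eq0 (t p)) (negPf tp) /= /q => /eqP -> /eqP ->.
    by rewrite !expr0n /= !mulr0 !addr0.
  have pw : p.1 * w.2 = p.2 * w.1.
    move/eqP: tp; rewrite !mulf_eq0 invr_eq0 (negPf qw) (negPf b0) orbF /=.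
    by rewrite addr_eq0 => /eqP ->; rewrite oppr_pchar2.
  (* p and w are proportional by pw, so q p and q w differ by a square factor *)
  have p1 : p.1 ^+ 2 * q w = w.1 ^+ 2 * q p.
    have -> : w.1 ^+ 2 * q p = a * (p.1 * w.1) ^+ 2
      + b * (p.1 * w.1 * (p.2 * w.1)) + c * (p.2 * w.1) ^+ 2 by rewrite /q; ring.
    by rewrite -pw /q; ring.
  have p2 : p.2 ^+ 2 * q w = w.2 ^+ 2 * q p.
    have -> : w.2 ^+ 2 * q p = a * (p.1 * w.2) ^+ 2
      + b * (p.1 * w.2 * (p.2 * w.2)) + c * (p.2 * w.2) ^+ 2 by rewrite /q; ring.
    by rewrite pw /q; ring.
  move/eqP: p1; move/eqP: p2; rewrite qp !mulr0 !mulf_eq0 (negPf qw) !orbF !orbb.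
  by move=> /eqP h2 /eqP h1; rewrite [LHS]surjective_pairing h1 h2.
apply: (@even_card_involution _ r) => p; rewrite !inE => /andP[p0 /eqP qp] //.
  rewrite -/(q (r p)) qr [q p]qp eqxx andbT; apply: contra_neq p0 => rp.
  by rewrite -(rK p) rp /r /t /= !(mul0r, add0r, mulr0).
by apply: contra_neq p0; apply: r0.
Qed.

End BinaryForm.

(** * The hyperbolic quadratic form *)

Section Symplectic.

Local Open Scope ring_scope.

Variables (F : finFieldType) (n : nat).
Hypothesis F2 : 2%N \in [pchar F].

Local Notation V := 'rV[F]_(n + n).
Local Notation form := (@sympl_form F n).

(** In characteristic 2, the hyperbolic quadratic form whose polarization is
    [sympl_form]; see [quad_comb]. *)
Definition quad (v : V) : F := (lsubmx v *m (rsubmx v)^T) 0 0.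

(** For a fixed first half x, the zeros of [quad] form the subspace orthogonal to
    x, which is nonzero because n > 1.  Translation by a nonzero vector t x of
    it is an involution without fixed points. *)
Lemma even_card_quad_zeros : (1 < n)%N -> ~~ odd #|[set v | quad v == 0]|.
Proof.
move=> n_gt1; pose t (x : 'rV[F]_n) := nz_row (kermx x^T).
have t_neq0 x : t x != 0.
  rewrite nz_row_eq0 -mxrank_eq0 mxrank_ker -lt0n subn_gt0.
  by rewrite (leq_ltn_trans (rank_leq_col _)).
have tx x : x *m (t x)^T = 0.
  apply/trmx_inj; rewrite trmx_mul trmxK trmx0; apply/eqP.
  by rewrite -sub_kermx nz_row_sub.
pose g (v : V) : V := v + row_mx 0 (t (lsubmx v)).
have lg v : lsubmx (g v) = lsubmx v by rewrite linearD /= row_mxKl addr0.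
have rg v : rsubmx (g v) = rsubmx v + t (lsubmx v) by rewrite linearD /= row_mxKr.
apply: (@even_card_involution _ g) => v; rewrite !inE => /eqP qv.
- by rewrite /quad lg rg linearD /= mulmxDr tx addr0 -/(quad v) qv.
- rewrite {1}/g lg /g -addrA -mulr2n -scaler_nat.
  by rewrite (pcharf0 F2) scale0r addr0.
apply: contra_neq (t_neq0 (lsubmx v)) => /(congr1 rsubmx).
by rewrite rg => /eqP; rewrite -subr_eq0 addrC addKr => /eqP.
Qed.

Lemma odd_card_quad_nonzero_zeros :
  (1 < n)%N -> odd #|[set v | (v != 0) && (quad v == 0)]|.
Proof.
have quad0 : quad 0 = 0 by rewrite /quad (linear0 (@lsubmx F 1 n n)) mul0mx mxE.
move=> /even_card_quad_zeros; rewrite [X in ~~ odd X](cardsD1 0) inE quad0 eqxx /= negbK.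
by congr (odd #|pred_of_set _|); apply/setP => v; rewrite !inE.
Qed.

Lemma sympl_formE u v : form u v =
  (lsubmx u *m (rsubmx v)^T) 0 0 - (lsubmx v *m (rsubmx u)^T) 0 0.
Proof.
rewrite /sympl_form -{1}[u]hsubmxK -{1}[v]hsubmxK.
rewrite mul_row_block !mulmx0 add0r addr0 mulmxN !mulmx1 tr_row_mx mul_row_col.
rewrite mxE addrC mulNmx [X in _ + X = _]mxE; congr (_ - _).
by rewrite -trace_mx11 -mxtrace_tr trmx_mul trmxK trace_mx11.
Qed.

Lemma sympl_formD u1 u2 v : form (u1 + u2) v = form u1 v + form u2 v.
Proof. by rewrite /sympl_form !mulmxDl mxE. Qed.

Lemma sympl_formZ a u v : form (a *: u) v = a * form u v.
Proof. by rewrite /sympl_form -!scalemxAl mxE. Qed.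

Lemma sympl_formZr a u v : form u (a *: v) = a * form u v.
Proof. by rewrite /sympl_form linearZ -scalemxAr mxE. Qed.

Lemma sympl_formC u v : form u v = - form v u.
Proof. by rewrite !sympl_formE opprB. Qed.

Lemma sympl_formvv v : form v v = 0.
Proof. by rewrite sympl_formE subrr. Qed.

Lemma quad_comb a b u v :
  quad (a *: u + b *: v) =
    quad u * a ^+ 2 + form u v * (a * b) + quad v * b ^+ 2.
Proof.
rewrite sympl_formE oppr_pchar2 // /quad !linearD !linearZ /=.
rewrite !mulmxDl -!scalemxAl !mxE; ring.
Qed.

Lemma hyperbolic_pair_free a b u v :
  form u v != 0 -> a *: u + b *: v = 0 -> a = 0 /\ b = 0.
Proof.
move=> uv0 abuv; have f0 w : form 0 w = 0 by rewrite /sympl_form !mul0mx mxE.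
have := f0 v; rewrite -{1}abuv sympl_formD !sympl_formZ sympl_formvv mulr0 addr0.
move/eqP; rewrite mulf_eq0 (negPf uv0) orbF => /eqP a0; split=> //.
have := f0 u; rewrite -{1}abuv sympl_formD !sympl_formZ sympl_formvv mulr0 add0r.
by move/eqP; rewrite mulf_eq0 sympl_formC oppr_eq0 (negPf uv0) orbF => /eqP.
Qed.

(** * Families of semisymplectic maps *)

(** Covers at once the semilinear maps that induce G2 and all the scalar
    multiples of those that induce G1. *)
Definition semisymplectic (g : V -> V) := exists sigma : F -> F,
  [/\ injective sigma, sigma 0 = 0,
      forall a b u v, g (a *: u + b *: v) = sigma a *: g u + sigma b *: g v
    & forall u v, form u v != 0 -> form (g u) (g v) != 0].

(** The incidence count for the nonzero singular vectors B of [quad] and for the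
    nonzero vectors of the plane spanned by a pair u, v with form u v != 0,
    parametrized by their coordinates: the count is odd by the sizes of the two
    sets and even because each image of the plane is again nondegenerate. *)
Lemma no_sharply_transitive_semisymplectic_family (I : finType) (D : {set I})
    (g : I -> V -> V) :
    (1 < n)%N -> (forall i, i \in D -> semisymplectic (g i)) ->
    (forall x y, x != 0 -> y != 0 -> exists! i, i \in D /\ g i x = y) ->
  False.
Proof.
move=> n_gt1 gS gtr.
have [u [v uv0]] : exists u v, form u v != 0.
  pose e : 'rV[F]_n := delta_mx 0 (Ordinal (ltnW n_gt1)).
  exists (row_mx e 0), (row_mx 0 e); rewrite sympl_formE !row_mxKl !row_mxKr.
  rewrite mul0mx /e trmx_delta mul_delta_mx !mxE eqxx subr0.
  exact: oner_neq0.
pose phi (p : F * F) := p.1 *: u + p.2 *: v.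
pose C := [set~ (0, 0) : F * F].
pose B := [set w : V | (w != 0) && (quad w == 0)].
have phi0 p : p \in C -> phi p != 0.
  rewrite !inE; apply: contra_neq => /(hyperbolic_pair_free uv0).
  by move=> [p1 p2]; rewrite [LHS]surjective_pairing p1 p2.
have Bodd : odd #|B| by apply: odd_card_quad_nonzero_zeros.
have F_even : ~~ odd #|F|.
  rewrite -cardsT.
  apply: (@even_card_involution _ (+%R 1)) => x _; rewrite ?inE //.
    by rewrite addrA -mulr2n (pcharf0 F2) add0r.
  by rewrite -subr_eq0 addrK oner_eq0.
have Codd : odd #|C|.
  have := cardsC1 ((0, 0) : F * F); rewrite card_prod -/C => ->.
  have F_gt0 : (0 < #|F|)%N by apply/card_gt0P; exists 0.
  have : (0 < #|F| * #|F|)%N by rewrite muln_gt0 F_gt0.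
  have : ~~ odd (#|F| * #|F|) by rewrite oddM (negPf F_even).
  by case: (_ * _)%N => //= k; rewrite negbK.
have : odd (#|C| * #|B|) by rewrite oddM Codd.
rewrite -(@sharply_transitive_incidence _ _ _ D (fun i p => g i (phi p))).
  apply/negP; rewrite -dvdn2; apply: dvdn_sum => i Di.
  have [s [s_inj s0 gE gform]] := gS i Di.
  have guv0 := gform u v uv0.
  have h_inj : injective (fun p : F * F => (s p.1, s p.2)).
    by move=> [a b] [c d] /= [/s_inj -> /s_inj ->].
  have h0 p : ((s p.1, s p.2) == (0, 0)) = (p == (0, 0)).
    by rewrite -{1 2}s0 (inj_eq h_inj (p) (0,0)).
  (* In coordinates g i is the bijection s on each factor, so the singular
     vectors in the image of the plane are the zeros of a binary form. *)
  have := even_card_binary_zeros F2 (quad (g i u)) (quad (g i v)) guv0.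
  rewrite -(card_preimset _ h_inj) -dvdn2.
  congr (2 %| #|pred_of_set _|)%N; apply/setP => p; rewrite !inE h0 gE quad_comb.
  have [//|p0] /= := eqVneq p (0, 0).
  case: (_ == _ :> F); rewrite ?andbF ?andbT //; apply/esym/eqP.
  by move=> /(hyperbolic_pair_free guv0)[s1 s2]; move: p0; rewrite -h0 s1 s2 eqxx.
move=> p w Cp; rewrite inE => /andP[w0 _].
by apply: gtr => //; apply: phi0.
Qed.

Definition semilin (A : 'M[F]_(n + n)) (s : {perm F}) (v : V) : V :=
  field_act s (linear_act A v).

Lemma field_Aut0 (s : {perm F}) : s \in field_Aut F -> s 0 = 0.
Proof. by move=> /field_AutP[sB _]; rewrite -{1}(subrr 0) sB subrr. Qed.

Lemma semisymplectic_semilin c A s : c != 0 -> A \in Sp F n -> s \in field_Aut F ->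
  semisymplectic (fun v => c *: semilin A s v).
Proof.
move=> c0 SA As; have s0 := field_Aut0 As; have [sB [s1 sM]] := field_AutP _ As.
have sN x : s (- x) = - s x by rewrite -(sub0r x) sB s0 sub0r.
have sD x y : s (x + y) = s x + s y by rewrite -{1}(opprK y) sB sN opprK.
exists s; split=> //; first exact: perm_inj.
  move=> a b u v; rewrite /semilin /linear_act mulmxDl -!scalemxAl.
  by apply/rowP => j; rewrite !mxE sD !sM; ring.
move=> u v; rewrite sympl_formZ sympl_formZr !mulf_eq0 (negPf c0) /=.
rewrite -(Sp_form _ _ SA) /semilin /linear_act.
move: (u *m A) (v *m A) => {}u {}v.
suff -> : form (field_act s u) (field_act s v) = s (form u v).
  by rewrite -{2}s0 (inj_eq perm_inj).
have s_sum (x y : 'rV[F]_n) :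
    (map_mx s x *m (map_mx s y)^T) 0 0 = s ((x *m y^T) 0 0).
  rewrite !mxE (big_morph s sD s0); apply: eq_bigr => i _.
  by rewrite !mxE sM.
by rewrite !sympl_formE sB /field_act -!map_lsubmx -!map_rsubmx !s_sum.
Qed.


(** * Reduction to semisymplectic families *)

Lemma G2P (s : {perm nzvec F n}) : s \in G2 F n ->
  exists A t, [/\ A \in Sp F n, t \in field_Aut F &
    forall x, val (s x) = semilin A t (val x)].
Proof.
case/mulsgP => a b; rewrite !inE.
move=> /exists_inP[A SA /forallP aE] /exists_inP[t At /forallP bE] ->.
by exists A, t; split=> // x; rewrite permM (eqP (bE _)) (eqP (aE _)).
Qed.

Lemma G1P (s : {perm point F n}) : s \in G1 F n ->
  exists A t, [/\ A \in Sp F n, t \in field_Aut F &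
    forall (U : point F n) v, v \in val U -> semilin A t v \in val (s U)].
Proof.
case/mulsgP => a b; rewrite !inE.
move=> /exists_inP[A SA /forallP aE] /exists_inP[t At /forallP bE] ->.
exists A, t; split=> // U v Uv; rewrite permM.
have : semilin A t v \in [set w in val (b (a U))]; last by rewrite inE.
rewrite (eqP (bE _)) (eqP (aE _)); do 2![apply: imset_f].
by rewrite inE.
Qed.

Lemma G2_not_sharply_transitive (S : {set {perm nzvec F n}}) :
  (1 < n)%N -> S \subset G2 F n -> ~ sharply_transitive S.
Proof.
move=> n_gt1 /subsetP sSG Str.
have repr (s : {perm nzvec F n}) : exists At : 'M[F]_(n + n) * {perm F},
    s \in S -> [/\ At.1 \in Sp F n, At.2 \in field_Aut F &
      forall x, val (s x) = semilin At.1 At.2 (val x)].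
  have [/sSG/G2P[A [t AtP]]|_] := boolP (s \in S).
    by exists (A, t).
  by exists (0, 1%g).
have [At AtP] := fin_all_exists repr.
(* The scalar 1 puts g in the form covered by semisymplectic_semilin. *)
pose g s v := 1 *: semilin (At s).1 (At s).2 v.
apply: (@no_sharply_transitive_semisymplectic_family _ S g) => // [s Ss|x y x0 y0].
  by have [SA Aut_t _] := AtP s Ss; apply: semisymplectic_semilin => //; apply: oner_neq0.
have gE s : s \in S -> forall x0' : x != 0, g s x = val (s (exist _ x x0')).
  by move=> Ss x0'; have [_ _ ->] := AtP s Ss; rewrite /g scale1r.
have [s [[Ss sxy] sU]] := Str (exist _ x x0) (exist _ y y0).
exists s; split=> [|s' [Ss' s'xy]].
  by split=> //; rewrite (gE s Ss x0) sxy.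
by apply: sU; split=> //; apply: val_inj; rewrite -gE.
Qed.

(** Lifts S to vectors: the pairs (s, c), with s in S and c a nonzero scalar, act
    as c times a semilinear map inducing s.  Sharp transitivity on points fixes
    s, and then the position of the image on its line fixes c. *)
Lemma G1_not_sharply_transitive (S : {set {perm point F n}}) :
  (1 < n)%N -> S \subset G1 F n -> ~ sharply_transitive S.
Proof.
move=> n_gt1 /subsetP sSG Str.
have repr (s : {perm point F n}) : exists At : 'M[F]_(n + n) * {perm F},
    s \in S -> [/\ At.1 \in Sp F n, At.2 \in field_Aut F &
      forall (U : point F n) v, v \in val U -> semilin At.1 At.2 v \in val (s U)].
  have [/sSG/G1P[A [t AtP]]|_] := boolP (s \in S).
    by exists (A, t).
  by exists (0, 1%g).
have [At AtP] := fin_all_exists repr.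
pose line x (x0 : x != 0) : point F n :=
  exist (fun U : {vspace V} => \dim U == 1%N) <[x]>%VS
    (introT eqP (etrans (dim_vline x) (congr1 nat_of_bool x0))).
pose h s := semilin (At s).1 (At s).2.
pose D : {set {perm point F n} * F} := [set i | (i.1 \in S) && (i.2 != 0)].
pose g (i : {perm point F n} * F) v := i.2 *: h i.1 v.
have gS i : i \in D -> semisymplectic (g i).
  rewrite inE => /andP[Si i0]; have [SA Aut_t _] := AtP _ Si.
  exact: semisymplectic_semilin.
have h_neq0 s x : s \in S -> x != 0 -> h s x != 0.
  move=> Ss x0; have [SA Aut_t _] := AtP s Ss.
  have uA : (At s).1 \in unitmx by move: SA; rewrite inE => /andP[].
  apply: contra_neq x0 => hx; rewrite -[x](mulmxK uA).
  rewrite (_ : x *m _ = 0) ?mul0mx //; apply/rowP => j; rewrite [RHS]mxE.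
  apply: (@perm_inj _ (At s).2); rewrite (field_Aut0 Aut_t).
  by move/rowP/(_ j): hx; rewrite !mxE.
have lineP s x (x0 : x != 0) y (y0 : y != 0) : s \in S ->
    (s (line x x0) = line y y0) <-> (exists2 c, c != 0 & c *: h s x = y).
  move=> Ss; have [_ _ hP] := AtP s Ss.
  have := hP (line x x0) x (memv_line x); rewrite -/(h s x) => hx.
  split=> [E|[c c0 cy]].
    move: hx; rewrite E => /vlineP[c hc].
    have c0 : c != 0.
      by apply: contra_neq (h_neq0 s x Ss x0) => c0; rewrite hc c0 scale0r.
    by exists c^-1; rewrite ?invr_eq0 // hc scalerA mulVf // scale1r.
  apply/esym/val_inj/eqP; rewrite /= eqEdim (eqP (valP (s (line x x0)))).
  by rewrite dim_vline y0 andbT -memvE -cy memvZ.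
apply: (@no_sharply_transitive_semisymplectic_family _ D g) => // x y x0 y0.
have [s [[Ss sxy] sU]] := Str (line x x0) (line y y0).
have [c c0 cy] := (lineP s x x0 y y0 Ss).1 sxy.
exists (s, c); split=> [|[s' c'] []]; first by rewrite inE Ss c0.
rewrite inE /= => /andP[Ss' c'0]; rewrite /g /= => c'y.
have E : s = s' by apply: sU; split=> //; apply/lineP => //; exists c'.
rewrite -E; congr pair; apply/eqP; rewrite -subr_eq0.
have : (c - c') *: h s x == 0 by rewrite scalerBl cy -c'y E subrr.
by rewrite scaler_eq0 (negPf (h_neq0 s x Ss x0)) orbF.
Qed.

End Symplectic.

Theorem theorem3 (n m : nat) (F : finFieldType) (hn : 2 <= n) (hm : 0 < m)
    (hF : #|F| = 2 ^ m) :
  (~ exists S : {set {perm point F n}},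
       S \subset G1 F n /\ sharply_transitive S) /\
  (~ exists S : {set {perm nzvec F n}},
       S \subset G2 F n /\ sharply_transitive S).
Proof.
have F2 := card_finPcharP hF isT.
by split=> -[S [SG]]; [apply: G1_not_sharply_transitive SG |
  apply: G2_not_sharply_transitive SG].
Qed.
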